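(* Let $G \in \mathcal{C}$ and let $v \in V(G)$ be such that $G-v \in \mathcal{C}$. Then $\mathrm{dom}_t(G) \leq \mathrm{dom}_t(G-v)+1$.
   Context: All graphs are finite and simple. $\mathcal{C}$ denotes the class of all connected graphs that contain a cycle. An orientation of a graph $G$ is a digraph obtained by directing each edge $uv$ of $G$ in exactly one of the two directions $(u,v)$ or $(v,u)$. The orientation is valid if every vertex has in-degree at least $1$. A set $S\subseteq V(D)$ is a total dominating set of a digraph $D$ if every vertex of $D$ (including those in $S$) has an in-neighbor in $S$; $\gamma_t(D)$ is the minimum cardinality of a total dominating set of $D$. For a graph $G$ in which every component contains a cycle (equivalently, $G$ has a valid orientation), $\mathrm{dom}_t(G)$ is the minimum of $\gamma_t(D)$ over all valid orientations $D$ of $G$. $G-v$ is the graph obtained from $G$ by deleting the vertex $v$ and all edges incident with it. *)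

(* Defs.v *)
From mathcomp Require Import all_boot.

Set Implicit Arguments.
Unset Strict Implicit.
Unset Printing Implicit Defensive.

Record sgraph := SGraph {
  vertex :> finType;
  edge : rel vertex;
  edge_sym : symmetric edge;
  edge_irr : irreflexive edge
}.

Definition connected_graph (G : sgraph) : Prop :=
  forall x y : G, connect (@edge G) x y.

(* [ucycle] also accepts sequences of length at most 2; in particular
   [:: x; y] is a [ucycle] for every edge xy, hence the size condition. *)
Definition contains_cycle (G : sgraph) : Prop :=
  exists2 c : seq G, 2 < size c & ucycle (@edge G) c.

(* The class C; the cycle makes the vertex set nonempty. *)
Definition inC (G : sgraph) : Prop := connected_graph G /\ contains_cycle G.

Definition del_edge (G : sgraph) (v : G) : rel {x : G | x != v} :=
  fun x y => edge (val x) (val y).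

Lemma del_edge_sym (G : sgraph) (v : G) : symmetric (del_edge (v := v)).
Proof. by move=> x y; apply: edge_sym. Qed.

Lemma del_edge_irr (G : sgraph) (v : G) : irreflexive (del_edge (v := v)).
Proof. by move=> x; apply: edge_irr. Qed.

Definition del_vertex (G : sgraph) (v : G) : sgraph :=
  SGraph (del_edge_sym (v := v)) (del_edge_irr (v := v)).

(* A digraph on T is given by its set of arcs, (x, y) being the arc from x
   to y. *)
Definition digraph (T : finType) := {set T * T}.

Definition total_dominating (T : finType) (D : digraph T) (S : {set T}) : bool :=
  [forall x, exists y in S, (y, x) \in D].

(* If every in-degree is at least 1 then the whole vertex set is total
   dominating, so the default value #|T| does not affect the minimum
   (see [gamma_tP]). *)
Definition gamma_t (T : finType) (D : digraph T) : nat :=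
  \big[minn/#|T|]_(S : {set T} | total_dominating D S) #|S|.

Definition orientation (G : sgraph) (D : digraph G) : bool :=
  [forall x : G, forall y : G,
     if edge x y then ((x, y) \in D) (+) ((y, x) \in D) else (x, y) \notin D].

Definition valid (T : finType) (D : digraph T) : bool :=
  [forall x, 0 < #|[set y | (y, x) \in D]|].

(* Since [gamma_t D <= #|G|] always holds, the default value #|G| does not
   affect the minimum as soon as G has a valid orientation
   (see [dom_tP]). *)
Definition dom_t (G : sgraph) : nat :=
  \big[minn/#|G|]_(D : digraph G | orientation D && valid D) gamma_t D.

Lemma bigminn_attained (I : finType) (P : pred I) (F : I -> nat) (m : nat) :
  (exists2 i, P i & F i <= m) ->
  (exists2 i, P i & F i = \big[minn/m]_(i | P i) F i) /\
  (forall i, P i -> \big[minn/m]_(i | P i) F i <= F i).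
Proof.
move=> [i0 Pi0 Fi0].
have lb i : P i -> \big[minn/m]_(i | P i) F i <= F i.
  move=> Pi; have := mem_index_enum i.
  elim: (index_enum I) => // j r IHr; rewrite inE big_cons.
  case/predU1P=> [<-|/IHr le_r]; first by rewrite Pi geq_minl.
  by case: ifP => // _; apply: leq_trans le_r; apply: geq_minr.
split=> //.
have : (exists2 i, P i & F i = \big[minn/m]_(i | P i) F i) \/
       \big[minn/m]_(i | P i) F i = m.
  apply: (big_ind (fun n => (exists2 i, P i & F i = n) \/ n = m)).
  - by right.
  - by move=> x y Hx Hy; rewrite /minn; case: ifP.
  - by move=> i Pi; left; exists i.
case=> // Em; exists i0 => //; apply/eqP.
by rewrite eqn_leq lb // andbT Em.
Qed.

Lemma gamma_tP (T : finType) (D : digraph T) : valid D ->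
  (exists2 S, total_dominating D S & #|S| = gamma_t D) /\
  (forall S, total_dominating D S -> gamma_t D <= #|S|).
Proof.
move=> /forallP vD; apply: bigminn_attained.
exists setT; last by rewrite cardsT.
apply/forallP=> x; have /card_gt0P[y] := vD x.
by rewrite inE => yx; apply/existsP; exists y; rewrite inE.
Qed.

Lemma dom_tP (G : sgraph) :
  (exists D : digraph G, orientation D && valid D) ->
  (exists2 D : digraph G, orientation D && valid D & gamma_t D = dom_t G) /\
  (forall D : digraph G, orientation D && valid D -> dom_t G <= gamma_t D).
Proof.
move=> [D oD]; apply: bigminn_attained; exists D => //.
have /andP[_ vD] := oD; have [[S _ <-] _] := gamma_tP vD.
exact: max_card.
Qed.

(* Main.v *)
Require Import Defs.
From mathcomp Require Import all_boot.

(** Let [D] be a valid orientation of [G - v] with a total dominating set [S].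
    Orient every edge at [v] towards [v]. No in-neighbour in [G - v] is lost,
    so [S] still dominates every vertex other than [v]; and [v] itself is
    dominated once one of its neighbours [u] is added to [S]. Such a [u] exists
    because [G] is connected and has a vertex other than [v]. The resulting
    orientation of [G] is valid, since a digraph with a total dominating set
    has no vertex of in-degree zero. Hence [dom_t G <= #|S| + 1]; minimizing
    over [S] and then over [D] gives the bound.

    The minima defining [dom_t] and [gamma_t] carry the number of vertices as
    default value, and [leq_bigminn] asks for the bound at that value too; there
    it reads [dom_t G <= #|G|], which holds because [#|G|] is the default value
    of the minimum on the left. *)

Lemma bigminn_le_default (I : finType) (P : pred I) (F : I -> nat) (m : nat) :
  \big[minn/m]_(i | P i) F i <= m.
Proof. by elim/big_rec: _ => // i n _; apply/leq_trans/geq_minr. Qed.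

Lemma leq_bigminn (I : finType) (P : pred I) (F : I -> nat) (m k : nat) :
  k <= m -> (forall i, P i -> k <= F i) -> k <= \big[minn/m]_(i | P i) F i.
Proof.
move=> km kF; apply: (big_ind (fun n => k <= n)) => // x y kx ky.
by rewrite leq_min kx.
Qed.

(** A dominating in-neighbour is in particular an in-neighbour, so validity of
    an extended orientation comes for free with its dominating set. *)
Lemma total_dominating_valid (T : finType) (D : digraph T) (S : {set T}) :
  total_dominating D S -> valid D.
Proof.
move=> /forallP domS; apply/forallP=> x.
have /existsP[y /andP[_ yx]] := domS x.
by apply/card_gt0P; exists y; rewrite inE.
Qed.

Lemma dom_t_le (G : sgraph) (D : digraph G) (S : {set G}) :
  orientation D -> total_dominating D S -> dom_t G <= #|S|.
Proof.
move=> oD domS; have vD := total_dominating_valid _ _ _ domS.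
have oVD : orientation D && valid D by rewrite oD.
apply: (leq_trans ((dom_tP (ex_intro _ D oVD)).2 D oVD)).
exact: (gamma_tP vD).2.
Qed.

(** The neighbour is the first vertex after [v] on a path from [v] to [w]. *)
Lemma connected_has_neighbor (G : sgraph) (v w : G) :
  connected_graph G -> w != v -> exists u, edge u v.
Proof.
move=> conG wv; have /connectP[[|u p] /= e_p def_w] := conG v w.
  by rewrite def_w eqxx in wv.
by have /andP[vu _] := e_p; exists u; rewrite edge_sym.
Qed.

Section ExtendOrientation.

Variables (G : sgraph) (v : G) (D : digraph (del_vertex v)).

(** Arcs of [D] live on the subtype of vertices other than [v]; [insub] detects
    the pairs of vertices of [G] coming from it, and every remaining edge has
    [v] as an end and is directed into [v]. *)
Definition extend_toward : digraph G :=
  [set p | if (insub p.1, insub p.2) is (Some a, Some b)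
           then ((a, b) : del_vertex v * del_vertex v) \in D
           else (p.2 == v) && edge p.1 p.2].

Lemma extend_towardE (a b : del_vertex v) :
  ((val a, val b) \in extend_toward) = ((a, b) \in D).
Proof. by rewrite inE /= !valK. Qed.

Lemma extend_toward_in x : ((x, v) \in extend_toward) = edge x v.
Proof.
rewrite inE /= [insub v]insubF ?eqxx //.
by case: insub.
Qed.

Lemma extend_toward_out (b : del_vertex v) :
  ((v, val b) \in extend_toward) = false.
Proof. by rewrite inE /= insubF ?eqxx // (negPf (valP b)). Qed.

(** Eliminator for [G] seen as [G - v] plus one point, matching the three
    preceding rewriting rules. *)
Lemma vertexP (P : G -> Prop) :
  P v -> (forall a : del_vertex v, P (val a)) -> forall x, P x.
Proof.
move=> Pv Pval x; case: (eqVneq x v) => [-> // | xv].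
exact: (Pval (Sub x xv : {x : G | x != v})).
Qed.

Lemma extend_toward_orientation : orientation D -> orientation extend_toward.
Proof.
move=> /forallP oD; apply/forallP=> x; apply/forallP=> y.
elim/vertexP: x => [|a]; elim/vertexP: y => [|b].
- by rewrite extend_toward_in edge_irr.
- by rewrite extend_toward_out extend_toward_in edge_sym; case: edge.
- by rewrite extend_toward_out extend_toward_in; case: edge.
- by rewrite !extend_towardE; have /forallP := oD a; apply.
Qed.

(** [u] dominates [v], and every other vertex keeps its in-neighbours in
    [G - v]. *)
Lemma extend_toward_dominating (S : {set del_vertex v}) (u : G) :
  edge u v -> total_dominating D S ->
  total_dominating extend_toward (u |: [set val a | a in S]).
Proof.
move=> uv /forallP domS; apply/forallP=> x; apply/existsP.
elim/vertexP: x => [|b]; first by exists u; rewrite setU11 extend_toward_in.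
have /existsP[a /andP[aS ab]] := domS b.
by exists (val a); rewrite extend_towardE ab setU1r // imset_f.
Qed.

End ExtendOrientation.

Theorem lemma2p9 (G : sgraph) (v : G) (hG : inC G)
  (hGv : inC (del_vertex v)) :
  dom_t G <= dom_t (del_vertex v) + 1.
Proof.
(* A vertex of the cycle in [G - v] provides [w] other than [v]. *)
have [conG _] := hG; have [_ [[|w c] // _ _]] := hGv.
have [u uv] := connected_has_neighbor G v (val w) conG (valP w).
have default_ok : dom_t G - 1 <= #|del_vertex v|.
  rewrite leq_subLR (leq_trans (bigminn_le_default _ _ _ _)) //.
  rewrite card_sig (cardD1 v) inE leq_add2l subset_leq_card //.
  by apply/subsetP=> x; rewrite !inE andbT.
(* With the summand 1 moved to the left, the right-hand side is a minimum. *)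
rewrite addnC -leq_subLR.
apply: leq_bigminn => // D /andP[oD _]; apply: leq_bigminn => // S domS.
have oE := extend_toward_orientation G v D oD.
have domE := extend_toward_dominating G v D S u uv domS.
rewrite leq_subLR (leq_trans (dom_t_le _ _ _ oE domE)) //.
by rewrite (leq_trans (leq_card_setU _ _)) // cards1 leq_add2l leq_imset_card.
Qed.
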